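(* Let $X$ be a real separable Banach space having a shrinking finite-dimensional decomposition (FDD) $(E_i)_{i=1}^\infty$ which, for some real number $q \geq 1$, satisfies a lower $q$ estimate. Then $\Theta_X(n) \lesssim n^{-1/q}$; that is, there is a constant $C>0$ such that $\Theta_X(n) \leq C\, n^{-1/q}$ for all $n \in \mathbb{N}$.
   Context: $B_X$ is the closed unit ball of $X$. For $A \subset X$, the essential inradius $\varrho(A) \in [0,\infty]$ is $$\varrho(A) = \sup\{ r>0 : \exists x \in A,\ \exists Y \subset X \text{ closed subspace with } \dim(X/Y)<\infty,\ x + r B_Y \subset A\},$$ where $B_Y = B_X \cap Y$ (and $\sup \emptyset = 0$). Let $\mathcal{C}(X)$ be the family of bounded closed convex subsets of $X$. The covering index is $$\Theta_X(n) = \inf\Big\{ \max_{1\le k\le n} \varrho(A_k) : (A_k)_{k=1}^n \subset \mathcal{C}(X),\ \bigcup_{k=1}^n A_k = B_X \Big\}, \qquad n \in \mathbb{N}.$$ An FDD of $X$ is a sequence $(E_i)_{i=1}^\infty$ of nonzero finite-dimensional subspaces such that every $x \in X$ has a unique expansion $x = \sum_{i=1}^\infty x_i$ with $x_i \in E_i$. It is shrinking if for every $x^* \in X^*$ the norm of the restriction of $x^*$ to the closed linear span of $\bigcup_{i \ge N} E_i$ tends to $0$ as $N \to \infty$. It satisfies a lower $q$ estimate if there is $c>0$ such that $\big\|\sum_{i=1}^k x_i\big\| \geq c\big(\sum_{i=1}^k \|x_i\|^q\big)^{1/q}$ for all $k \in \mathbb{N}$ and all $x_i \in E_i$, $1\le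 i \le k$. *)

(* Defs.v *)
From HB Require Import structures.
From mathcomp Require Import all_boot all_order all_algebra.
From mathcomp Require Import all_classical all_reals all_analysis.
Import Order.TTheory GRing.Theory Num.Theory.
Import numFieldNormedType.Exports.

Set Implicit Arguments.
Unset Strict Implicit.
Unset Printing Implicit Defensive.

Local Open Scope classical_set_scope.
Local Open Scope ring_scope.

Definition separable_space (T : topologicalType) : Prop :=
  exists2 S : set T, countable S & dense S.

Section Subspaces.
Context {R : realType} {X : normedModType R}.

Definition linear_subspace (Y : set X) : Prop := submod_closed (mem Y).

Definition linear_span (S : set X) : set X :=
  [set x | exists (m : nat) (a : 'I_m -> R) (v : 'I_m -> X),
     (forall i, S (v i)) /\ x = \sum_(i < m) a i *: v i].

Definition finite_dimensional (Y : set X) : Prop :=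
  exists (m : nat) (v : 'I_m -> X), Y = linear_span (range v).

(* dim (X / Y) < oo: the quotient is spanned by the classes mod Y of finitely
   many vectors. *)
Definition finite_codimensional (Y : set X) : Prop :=
  exists (m : nat) (v : 'I_m -> X),
    forall x, exists2 y, linear_span (range v) y & Y (x - y).

End Subspaces.

Definition unit_ball (R : realType) (X : normedModType R) : set X :=
  [set x | `|x| <= 1].
Arguments unit_ball {R} X.

Section CoveringIndex.
Context {R : realType}.

(* The point 0 is added so that the supremum of the empty set is 0 and not
   -oo. *)
Definition essential_inradius (X : normedModType R) (A : set X) : \bar R :=
  ereal_sup (0%E |` [set r%:E | r in [set r : R | 0 < r /\
    exists x (Y : set X), [/\ A x, linear_subspace Y, closed Y,
      finite_codimensional Y &
      [set x + r *: y | y in unit_ball X `&` Y] `<=` A]]]).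

Definition bounded_closed_convex (X : normedModType R) (A : set X) : Prop :=
  [/\ bounded_set A, closed A & convex_set A].

Definition covering_index (X : normedModType R) (n : nat) : \bar R :=
  ereal_inf [set \big[maxe/0%E]_(k < n) essential_inradius (A k) |
    A in [set A : 'I_n -> set X |
      (forall k, bounded_closed_convex (A k)) /\
      \bigcup_k A k = unit_ball X]].

End CoveringIndex.

(* Decompositions (E_i) are indexed from 0. *)
Section FDD.
Context {R : realType} {X : normedModType R}.
Implicit Types E : nat -> set X.

Definition is_FDD E : Prop :=
  (forall i, [/\ linear_subspace (E i), finite_dimensional (E i) &
                 exists2 x, E i x & x != 0]) /\
  (forall x : X, exists! x_ : nat -> X,
     (forall i, E i (x_ i)) /\ series x_ @ \oo --> x).

Definition restriction_norm (f : X -> R^o) (Z : set X) : \bar R :=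
  ereal_sup [set `|f z|%:E | z in unit_ball X `&` Z].

Definition shrinking E : Prop :=
  forall f : {linear X -> R^o}, continuous f ->
    restriction_norm f
      (closure (linear_span (\bigcup_(i in [set i | (N <= i)%N]) E i)))
      @[N --> \oo] --> 0%E.

Definition lower_estimate E (q : R) : Prop :=
  exists2 c : R, 0 < c &
    forall (k : nat) (x_ : 'I_k -> X), (forall i : 'I_k, E i (x_ i)) ->
      c * (\sum_(i < k) `|x_ i| `^ q) `^ q^-1 <= `|\sum_(i < k) x_ i|.

End FDD.

(* Main.v *)
Require Import Defs.
From HB Require Import structures.
From mathcomp Require Import all_boot all_order all_algebra.
From mathcomp Require Import all_classical all_reals all_analysis.
From mathcomp Require Import ring lra.
Import Order.TTheory GRing.Theory Num.Theory.
Import numFieldNormedType.Exports.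

(** Let P i be the i-th coordinate map of the decomposition and c the constant of
    the lower q estimate. Passing to the limit in that estimate,

      c^q (sum_i |P i x|^q) <= |x|^q   for all x in X.

    Hence a point x of the unit ball cannot have n different coordinates of norm
    larger than t = c^-1 n^(-1/q). Split the indices into n infinite classes, the
    residue classes modulo n, and let A_k be the set of points of the unit ball all
    of whose coordinates of index congruent to k have norm at most t. Each A_k is
    bounded, closed and convex, and the A_k cover the ball by pigeonhole
    ([small_residue_class]).

    The essential inradius of A_k is at most t ([slab_essential_inradius]). Let Y be
    a closed subspace of finite codimension and choose a unit vector e i in each
    E i. Since the decomposition is shrinking, the sequence e is weakly null
    ([shrinking_weakly_null]), and a weakly null sequence gets arbitrarily close to
    Y ([weakly_null_near_subspace]) because Y is cut out by finitely many
    continuous functionals. So for large i in the k-th class, Y contains a vector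
    of norm about 1 with i-th coordinate of norm about 1, and a translate of r B_Y
    inside A_k forces r <= t. The estimate thus holds with the constant 1 / c.

    The functionals that cut out Y are built by hand in [coordinate_functional]:
    the coordinate along v is continuous on Z + R v whenever Z is closed and does
    not contain v, and finite sums Y + R v_1 + ... + R v_m of a closed subspace and
    lines are closed ([foldr_adjoin_closed]). *)

Set Implicit Arguments.
Unset Strict Implicit.
Unset Printing Implicit Defensive.

Local Open Scope classical_set_scope.
Local Open Scope ring_scope.

(** * Closed subspaces of finite codimension and weakly null sequences *)

Section Subspaces.
Context {R : realType} {X : normedModType R}.
Implicit Types (Y Z : set X) (v x y z : X) (s : seq X) (a r : R).

Lemma subspace0 Y : linear_subspace Y -> Y 0.
Proof. by case=> Y0 _; rewrite inE in Y0. Qed.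

Lemma subspaceDZ Y a x y : linear_subspace Y -> Y x -> Y y -> Y (a *: x + y).
Proof.
by move=> [_ YL] Yx Yy; have := YL a x y; rewrite !inE; exact.
Qed.

Lemma subspaceD Y x y : linear_subspace Y -> Y x -> Y y -> Y (x + y).
Proof. by move=> YL Yx Yy; rewrite -[x]scale1r; exact: subspaceDZ. Qed.

Lemma subspaceZ Y a x : linear_subspace Y -> Y x -> Y (a *: x).
Proof.
move=> YL Yx; rewrite -[_ *: _]addr0.
by apply: subspaceDZ => //; exact: subspace0.
Qed.

Lemma subspaceN Y x : linear_subspace Y -> Y x -> Y (- x).
Proof. by move=> YL Yx; rewrite -scaleN1r; exact: subspaceZ. Qed.

Lemma subspaceB Y x y : linear_subspace Y -> Y x -> Y y -> Y (x - y).
Proof. by move=> YL Yx Yy; apply: subspaceD => //; exact: subspaceN. Qed.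

Lemma subspace_sum Y (m : nat) (w : 'I_m -> X) :
  linear_subspace Y -> (forall i, Y (w i)) -> Y (\sum_i w i).
Proof.
move=> YL Yw; apply: (big_ind Y) => //; first exact: subspace0.
by move=> x y; exact: subspaceD.
Qed.

Lemma closedP_norm (A : set X) :
  (forall x, (forall r, 0 < r -> exists2 y, A y & `|x - y| <= r) -> A x) <->
  closed A.
Proof.
split=> [Acl x clAx|clA x Ax].
  apply: Acl => r r0; have [y [Ay]] := clAx _ (nbhsx_ballx x r r0).
  by rewrite -ball_normE /= => /ltW xy; exists y.
apply: clA => B /nbhs_ballP[r /= r0 rB].
have [y Ay xy] := Ax (r / 2) (divr_gt0 r0 (ltr0Sn _ _)).
exists y; split=> //; apply: rB; rewrite -ball_normE /=.
by rewrite (le_lt_trans xy) // ltr_pdivrMr // ltr_pMr // ltr1n.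
Qed.

(** A vector outside Y lies at a positive distance d from Y, and by homogeneity
    the component of a vector along v is then at most its norm divided by d.
    This one inequality gives both the closedness of Y + R v and the continuity
    of the coordinate along v. *)
Lemma closed_subspace_transversal Y v :
  linear_subspace Y -> closed Y -> ~ Y v ->
  exists2 d : R, 0 < d & forall a y, Y y -> `|a| * d <= `|a *: v + y|.
Proof.
move=> YL /closedP_norm Ycl NYv.
have [d d0 dP] : exists2 d, 0 < d & forall y, Y y -> d < `|v - y|.
  apply: contrapT => H; apply: NYv; apply: Ycl => r r0.
  apply: contrapT => Hr; apply: H; exists r => // y Yy.
  by rewrite ltNge; apply/negP => vy; apply: Hr; exists y.
exists d => // a y Yy; have [->|a0] := eqVneq a 0.
  by rewrite normr0 mul0r.
have -> : a *: v + y = a *: (v - (- a^-1) *: y).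
  by rewrite scaleNr opprK scalerDr scalerA divff // scale1r.
rewrite normrZ ler_wpM2l // ltW // dP //; exact: subspaceZ.
Qed.

(** The sum of Y and the line through v. Iterating this over a list, rather than
    adding a whole span at once, lets closedness and codimension be handled one
    vector at a time. *)
Definition adjoin v Y : set X := [set x | exists a, Y (x - a *: v)].

Lemma adjoin_sub v Y : Y `<=` adjoin v Y.
Proof. by move=> x Yx; exists 0; rewrite scale0r subr0. Qed.

Lemma adjoin_mem v Y : linear_subspace Y -> adjoin v Y v.
Proof. by move=> YL; exists 1; rewrite scale1r subrr; exact: subspace0. Qed.

Lemma adjoin_subspace v Y : linear_subspace Y -> linear_subspace (adjoin v Y).
Proof.
move=> YL; split; first by rewrite inE; apply: adjoin_sub; exact: subspace0.
move=> c x y; rewrite !inE => -[a Ya] [b Yb]; exists (c * a + b).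
have -> : c *: x + y - (c * a + b) *: v = c *: (x - a *: v) + (y - b *: v).
  by rewrite scalerBr scalerA scalerDl opprD addrACA.
exact: subspaceDZ.
Qed.

(** Let x be in the closure of Y + R v. If x - a v and x - b v are within r and r'
    of Y, then |a - b| <= (r + r') / d, where d comes from
    [closed_subspace_transversal]. The intervals [a - r / d, a + r / d] therefore
    meet pairwise, hence have a common point b, and x - b v is at distance 0 from
    the closed set Y. *)
Lemma adjoin_closed v Y :
  linear_subspace Y -> closed Y -> closed (adjoin v Y).
Proof.
move=> YL Ycl; have [Yv|NYv] := pselect (Y v).
  suff -> : adjoin v Y = Y by [].
  apply/seteqP; split; last exact: adjoin_sub.
  move=> x [a Ya]; rewrite -(subrK (a *: v) x).
  by apply: subspaceD => //; exact: subspaceZ.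
have [d d0 dP] := closed_subspace_transversal YL Ycl NYv.
apply/closedP_norm => x Hx.
pose near_coef a r := exists2 y, Y y & `|x - a *: v - y| <= r.
have coef_ex r : 0 < r -> exists a, near_coef a r.
  move=> /Hx[z [a Ya] xz]; exists a; exists (z - a *: v) => //.
  by rewrite opprB subrKA.
have coef_near a b r r' : near_coef a r -> near_coef b r' ->
    a - r / d <= b + r' / d.
  move=> [y Yy ay] [y' Yy' ay'].
  have : `|a - b| * d <= r + r'.
    apply: le_trans (dP (a - b) (y - y') _) _; first exact: subspaceB.
    have -> : (a - b) *: v + (y - y') =
        (x - b *: v - y') - (x - a *: v - y).
      rewrite scalerBl -![x - _ - _]addrA opprD [RHS]addrACA subrr add0r.
      by rewrite !opprD !opprK [RHS]addrC [RHS]addrACA.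
    by rewrite (le_trans (ler_normB _ _)) // [leLHS]addrC lerD.
  rewrite -ler_pdivlMr // mulrDl => abd.
  by have := ler_norm (a - b); lra.
(* The supremum of the left endpoints belongs to every interval. *)
pose S := [set a | exists b, exists2 r, 0 < r & near_coef b r /\ a = b - r / d].
have S0 : S !=set0.
  have [a a1] := coef_ex 1 ltr01.
  by exists (a - 1 / d), a, 1.
have Sub b r : near_coef b r -> ubound S (b + r / d).
  by move=> br _ [a [r' r'0 [ar' ->]]]; exact: coef_near ar' br.
have supS : has_sup S.
  have [a a1] := coef_ex 1 ltr01.
  by split=> //; exists (a + 1 / d); exact: Sub.
have supP b r : 0 < r -> near_coef b r -> `|b - sup S| <= r / d.
  move=> r0 br; have := ge_sup S0 (Sub _ _ br).
  have : b - r / d <= sup S by apply: sup_upper_bound => //; exists b, r.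
  by move=> ? ?; rewrite ler_norml; apply/andP; split; lra.
exists (sup S); move/closedP_norm : Ycl; apply=> r r0.
(* Replacing b by the supremum moves x - b v by at most (r' / d) |v|, so
   precision r' on b gives precision r' (1 + |v| / d) = r at the supremum. *)
have vd0 : 0 < 1 + `|v| / d by rewrite ltr_wpDr // divr_ge0 // ltW.
pose r' := r / (1 + `|v| / d).
have r'0 : 0 < r' by rewrite divr_gt0.
have [b br] := coef_ex _ r'0.
have := supP _ _ r'0 br; have [y Yy xy bS] := br.
exists y => //.
have -> : x - sup S *: v - y = (x - b *: v - y) + (b - sup S) *: v.
  by rewrite scalerBl [RHS]addrAC subrKA.
apply: le_trans (ler_normD _ _) _; rewrite normrZ.
apply: le_trans (lerD xy (ler_wpM2r (normr_ge0 v) bS)) _.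
have -> : r' + r' / d * `|v| = r' * (1 + `|v| / d) by ring.
by rewrite /r' divfK // gt_eqF.
Qed.

(** When Y has codimension one, writing each x as y + f(x) v defines the functional
    f with kernel Y and f(v) = 1; it is bounded by the reciprocal of the distance
    from v to Y. *)
Lemma coordinate_functional Y v :
  linear_subspace Y -> closed Y -> ~ Y v -> (forall x, adjoin v Y x) ->
  exists2 f : {linear X -> R^o},
    continuous f & forall x, Y (x - f x *: v).
Proof.
move=> YL Ycl NYv /choice[f Yf].
have [d d0 dP] := closed_subspace_transversal YL Ycl NYv.
have f_uniq x a : Y (x - a *: v) -> f x = a.
  move=> Ya; apply/eqP; rewrite -subr_eq0 -normr_le0.
  rewrite -(pmulr_lle0 _ d0).
  have /dP - /(_ (f x - a)) := subspaceB YL (Yf x) Ya.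
  rewrite scalerBl opprB [X in _ <= `|X|]addrC [X in _ <= `|X|]addrAC.
  by rewrite !subrKA subrr normr0.
have f_lin : linear (f : X -> R^o).
  move=> c x y; apply: f_uniq.
  have -> : c *: x + y - (c *: f x + f y) *: v =
      c *: (x - f x *: v) + (y - f y *: v).
    by rewrite scalerBr scalerA scalerDl opprD addrACA.
  exact: subspaceDZ.
pose F : {linear X -> R^o} :=
  HB.pack (f : X -> R^o) (GRing.isLinear.Build _ _ _ _ _ f_lin).
exists F => //; apply/linear_bounded_continuous/linear_boundedP.
near=> r => x; rewrite /=.
have : `|f x| * d <= `|x|.
  by rewrite -[X in _ <= `|X|](subrK (f x *: v)) addrC; exact: dP.
rewrite -ler_pdivlMr // mulrC => /le_trans; apply.
by rewrite ler_wpM2r.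
Unshelve. all: by end_near. Qed.

Lemma foldr_adjoin_subspace Y s :
  linear_subspace Y -> linear_subspace (foldr adjoin Y s).
Proof. by move=> YL; elim: s => //= v s; exact: adjoin_subspace. Qed.

Lemma foldr_adjoin_closed Y s :
  linear_subspace Y -> closed Y -> closed (foldr adjoin Y s).
Proof.
move=> YL Ycl; elim: s => //= v s; apply: adjoin_closed.
exact: foldr_adjoin_subspace.
Qed.

Lemma foldr_adjoin_sub Y s : Y `<=` foldr adjoin Y s.
Proof.
elim: s => //= v s IH; apply: subset_trans IH _; exact: adjoin_sub.
Qed.

Lemma foldr_adjoin_mem Y s v :
  linear_subspace Y -> v \in s -> foldr adjoin Y s v.
Proof.
move=> YL; elim: s => //= w s IH; rewrite inE => /orP[/eqP ->|/IH vs].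
  by apply: adjoin_mem; exact: foldr_adjoin_subspace.
exact: adjoin_sub.
Qed.

Lemma adjoinC v w Y : adjoin v (adjoin w Y) = adjoin w (adjoin v Y).
Proof.
suff adjoinCsub v' w' : adjoin v' (adjoin w' Y) `<=` adjoin w' (adjoin v' Y).
  by apply/seteqP; split; exact: adjoinCsub.
by move=> x [a [b Yab]]; exists b, a; rewrite addrAC.
Qed.

Lemma foldr_adjoinC v Y s :
  foldr adjoin (adjoin v Y) s = adjoin v (foldr adjoin Y s).
Proof. by elim: s => //= w s ->; exact: adjoinC. Qed.

Lemma finite_codimensional_adjoin Y :
  linear_subspace Y -> finite_codimensional Y ->
  exists s, forall x, foldr adjoin Y s x.
Proof.
move=> YL [m [v Yv]]; exists [seq v i | i <- enum 'I_m] => x.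
have [_ [k [a [w [wv ->]]]]] := Yv x.
set y := \sum_(i < k) _ => Yxy; rewrite -(subrK y x).
have ZL := foldr_adjoin_subspace [seq v i | i <- enum 'I_m] YL.
apply: subspaceD => //; first exact: foldr_adjoin_sub.
apply: subspace_sum => // i; apply: subspaceZ => //.
have [j _ <-] := wv i; apply: foldr_adjoin_mem => //.
by apply/mapP; exists j => //; rewrite mem_enum.
Qed.

Definition weakly_null (e : nat -> X) :=
  forall f : {linear X -> R^o}, continuous f -> f (e i) @[i --> \oo] --> (0 : R).

(** Only finitely many functionals see X / Y, and each of them tends to 0 along a
    weakly null sequence. By induction on a list v :: s that spans X modulo Y: the
    subspace Z = Y + span s either is all of X, and v may be dropped, or is the
    kernel of a continuous f with f(v) = 1. In the second case e i is close to some
    y' = y + a v of Y + R v by induction, and a = f(y') is small since f(e i) is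
    small, so that e i is close to y too. *)
Lemma weakly_null_near_subspace (e : nat -> X) Y :
  weakly_null e -> linear_subspace Y -> closed Y -> finite_codimensional Y ->
  forall r, 0 < r -> \forall i \near \oo, exists2 y, Y y & `|e i - y| <= r.
Proof.
move=> e0 YL Ycl /(finite_codimensional_adjoin YL)[s].
elim: s Y YL Ycl => /= [Y _ _ YT r r0|v s IH Y YL Ycl YT r r0].
  by near=> i; exists (e i) => //; rewrite subrr normr0 ltW.
set Z := foldr adjoin Y s in YT.
have ZL : linear_subspace Z by exact: foldr_adjoin_subspace.
have [Zv|NZv] := pselect (Z v).
  apply: IH => // x; have [a Za] := YT x; rewrite -(subrK (a *: v) x).
  by apply: subspaceD => //; exact: subspaceZ.
have [f f_cont fZ] := coordinate_functional ZL
  (foldr_adjoin_closed YL Ycl) NZv YT.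
have [M M0 fM] : exists2 M : R, 0 < M & forall x, `|f x : R| <= M * `|x|.
  have /linear_bounded_continuous/linear_boundedP/pinfty_ex_gt0 := f_cont.
  by move=> [M M0 fM]; exists M.
have v0 : 0 <= `|v| by [].
(* If |e i - y'| and |f (e i)| are at most r', then |a| <= (1 + M) r', hence
   |e i - y| <= r' + (1 + M) r' |v|. *)
pose r' := r / (1 + (1 + M) * `|v|).
have den0 : 0 < 1 + (1 + M) * `|v| by nra.
have r'0 : 0 < r' by rewrite divr_gt0.
have foldT x : foldr adjoin (adjoin v Y) s x by rewrite foldr_adjoinC.
have near_v := IH _ (@adjoin_subspace v Y YL) (@adjoin_closed v Y YL Ycl)
  foldT r' r'0.
have /cvgrPdist_le /(_ r' r'0) f_small := e0 f f_cont.
near=> i.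
have [y' [a Ya] ey'] : exists2 y, adjoin v Y y & `|e i - y| <= r'.
  by near: i.
have fi : `|f (e i) : R| <= r'.
  rewrite -normrN -sub0r; near: i; exact: f_small.
exists (y' - a *: v) => //.
have fy' : f y' = a.
  apply: contrapT => Nfa; apply: NZv.
  have := subspaceB ZL (foldr_adjoin_sub s Ya) (fZ y').
  rewrite opprB addrC subrKA -scalerBl => /(subspaceZ (f y' - a)^-1 ZL).
  by rewrite scalerA mulVf ?scale1r // subr_eq0; apply/eqP.
have a_small : `|a| <= (1 + M) * r'.
  have := fM (e i - y'); rewrite linearB /= fy' => fey'.
  have := ler_normB (f (e i)) (f (e i) - a); rewrite subKr => H.
  have : M * `|e i - y'| <= M * r' by rewrite ler_pM2l.
  by move: H fey' fi; lra.
rewrite opprB addrA -addrAC.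
rewrite (le_trans (ler_normD _ _)) // normrZ.
have rE : r' * (1 + (1 + M) * `|v|) = r by rewrite divfK ?gt_eqF.
by rewrite -rE mulrDr mulr1 mulrCA mulrA lerD // ler_wpM2r.
Unshelve. all: by end_near. Qed.

End Subspaces.

(** * Coordinates of a finite-dimensional decomposition *)

Section Coordinates.
Context {R : realType} {X : normedModType R} (E : nat -> set X)
  (E_FDD : is_FDD E).

Let E_subspace i : linear_subspace (E i).
Proof. by have [EP _] := E_FDD; have [] := EP i. Qed.

(** Linearity of the coordinates is the uniqueness of expansions, applied to linear
    combinations and to the one-term expansion of a vector of E i. *)
Lemma FDD_coordinates : exists P : nat -> {linear X -> X},
  [/\ forall i x, E i (P i x),
      forall x, series (fun i => P i x) @ \oo --> x &
      forall i x, E i x -> P i x = x].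
Proof.
have [_ /choice[p pP]] := E_FDD.
have p_uniq x z : (forall i, E i (z i)) -> series z @ \oo --> x ->
    p x = z by move=> Ez zx; apply: (pP x).2.
have Ep x i : E i (p x i) by have [[]] := pP x.
have p_cvg x : series (p x) @ \oo --> x by have [[]] := pP x.
have p_lin i : linear (p^~ i).
  move=> a x y.
  rewrite (p_uniq _ (fun j => a *: p x j + p y j)) //.
    by move=> j; exact: subspaceDZ.
  have -> : series (fun j => a *: p x j + p y j) =
      (fun n => a *: series (p x) n + series (p y) n).
    by apply/funext => n; rewrite /series /= big_split scaler_sumr.
  by apply: cvgD => //; apply: cvgZr.
pose P i : {linear X -> X} :=
  HB.pack (p^~ i : X -> X) (GRing.isLinear.Build _ _ _ _ _ (p_lin i)).
exists P; split=> [i x|x|i x Ex]; [exact: Ep|exact: p_cvg|].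
pose z j := if j == i then x else 0.
have -> : P i x = p x i by [].
rewrite (p_uniq x z) /z ?eqxx // => [j|].
  by case: eqP => [->|_] //; exact: subspace0.
apply: cvg_near_cst; near=> n.
have ni : (i < n)%N by near: n; exact: nbhs_infty_gt.
rewrite /series /= big_mkord (bigD1 (Ordinal ni)) //= eqxx big1 ?addr0 // => j.
by rewrite -val_eqE /= => /negbTE ->.
Unshelve. all: by end_near. Qed.

Lemma FDD_unit_vectors :
  exists e : nat -> X, forall i, E i (e i) /\ `|e i| = 1.
Proof.
have [EP _] := E_FDD.
suff /choice[e eP] : forall i, exists e, E i e /\ `|e| = 1 by exists e.
move=> i; have [_ _ [x Ex x0]] := EP i.
exists (`|x|^-1 *: x); split; first exact: subspaceZ.
by rewrite normrZ normfV normr_id mulVf ?normr_eq0.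
Qed.

(** The vector e i lies in the tail span from index i on, where f has small norm. *)
Lemma shrinking_weakly_null (e : nat -> X) :
  shrinking E -> (forall i, E i (e i) /\ `|e i| <= 1) -> weakly_null e.
Proof.
move=> Eshr eP f f_cont; have /fine_cvgP[fin_norm norm0] := Eshr f f_cont.
apply/cvgrPdist_le => r r0; move/cvgrPdist_le : norm0 => /(_ r r0) norm0.
near=> i; rewrite sub0r normrN.
have fin_i : restriction_norm f (closure (linear_span
    (\bigcup_(j in [set j | (i <= j)%N]) E j))) \is a fin_num by near: i.
have : `|0 - fine (restriction_norm f (closure (linear_span
    (\bigcup_(j in [set j | (i <= j)%N]) E j))))| <= r by near: i.
rewrite sub0r normrN => /(le_trans (ler_norm _)); apply: le_trans.
rewrite -lee_fin fineK //; apply: ereal_sup_ubound; exists (e i) => //.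
have [Ee e1] := eP i; split => //; apply: subset_closure.
exists 1, (fun=> 1), (fun=> e i); split; first by move=> _; exists i => //=.
by rewrite big_ord1 scale1r.
Unshelve. all: by end_near. Qed.

(** The partial sums of the expansion of x satisfy the lower estimate and converge
    to x in norm, and lengthening them only increases the sum of q-th powers. *)
Lemma lower_estimate_expansion (P : nat -> {linear X -> X}) (c q : R) x n :
  0 < c -> 0 < q ->
  (forall i x, E i (P i x)) -> (forall x, series (fun i => P i x) @ \oo --> x) ->
  (forall (k : nat) (x_ : 'I_k -> X), (forall i : 'I_k, E i (x_ i)) ->
      c * (\sum_(i < k) `|x_ i| `^ q) `^ q^-1 <= `|\sum_(i < k) x_ i|) ->
  c * (\sum_(i < n) `|P i x| `^ q) `^ q^-1 <= `|x|.
Proof.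
move=> c0 q0 EP Pcvg low; apply: cvgr_to_ge (cvg_norm (Pcvg x)) _.
near=> m; rewrite /series /= big_mkord.
apply: le_trans (low m (fun i => P i x) _) => //.
rewrite ler_pM2l //; apply: ge0_ler_powR; rewrite ?nnegrE ?invr_ge0 ?(ltW q0) //.
- by apply: sumr_ge0 => i _; exact: powR_ge0.
- by apply: sumr_ge0 => i _; exact: powR_ge0.
have nm : (n <= m)%N by near: m; exact: nbhs_infty_ge.
rewrite -!(big_mkord xpredT (fun i => `|P i x| `^ q)) (big_cat_nat (leq0n n) nm) //=.
by rewrite lerDl sumr_ge0 // => i _; exact: powR_ge0.
Unshelve. all: by end_near. Qed.

End Coordinates.

(** * The sets of the covering *)

Section Slabs.
Context {R : realType} {X : normedModType R} (P : nat -> {linear X -> X})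
  (J : set nat) (t : R).

Definition slab : set X :=
  [set x | `|x| <= 1 /\ forall i, J i -> `|P i x| <= t].

(** Boundedness of each P i makes the constraints |P i x| <= t closed conditions. *)
Lemma slab_bounded_closed_convex (c : R) : 0 < c ->
  (forall i x, c * `|P i x| <= `|x|) -> bounded_closed_convex slab.
Proof.
move=> c0 Pbnd; split.
- by exists 1; split=> // M M1 x [x1 _]; exact: le_trans x1 (ltW M1).
- apply/closedP_norm => x Hx; split=> [|i Ji]; apply/ler_addgt0Pr => r r0.
    have [y [y1 _] xy] := Hx r r0; rewrite -(subrK y x) addrC.
    by rewrite (le_trans (ler_normD _ _)) // lerD.
  have [y [_ /(_ i Ji) Py] xy] := Hx (c * r) (mulr_gt0 c0 r0).
  rewrite -(subrK y x) addrC linearD (le_trans (ler_normD _ _)) // lerD //.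
  by rewrite -(ler_pM2l c0) (le_trans (Pbnd _ _)).
- move=> x y l; rewrite !inE => -[x1 Px] [y1 Py].
  have conv_le (u v : X) (b : R) : `|u| <= b -> `|v| <= b ->
      `|l%:num *: u + (1 - l%:num) *: v| <= b.
    move=> ub vb; have l0 : 0 <= l%:num :> R by [].
    have l1 : 0 <= 1 - l%:num :> R by rewrite subr_ge0.
    rewrite (le_trans (ler_normD _ _)) // !normrZ !ger0_norm //.
    apply: le_trans (lerD (ler_wpM2l l0 ub) (ler_wpM2l l1 vb)) _.
    by rewrite -mulrDl addrC subrK mul1r.
  split=> [|i Ji]; first exact: conv_le.
  by rewrite linearD !linearZ; apply: conv_le; [exact: Px|exact: Py].
Qed.

(** Suppose x + r B_Y lies in the slab. For a large index i of J the vector e i,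
    which is weakly null and of norm one, is within d of some y of Y, so that P i y
    has norm at least 1 - d / c. Both x + r y / (1 + d) and x - r y / (1 + d) lie in
    the slab, hence so does half their difference as far as the i-th constraint is
    concerned: (r / (1 + d)) |P i y| <= t. Letting d tend to 0 gives r <= t. *)
Lemma slab_essential_inradius (c : R) (e : nat -> X) :
  0 < c -> 0 <= t -> (forall i x, c * `|P i x| <= `|x|) ->
  weakly_null e -> (forall i, `|e i| = 1 /\ P i (e i) = e i) ->
  (forall N, exists2 i, (N <= i)%N & J i) ->
  (essential_inradius slab <= t%:E)%E.
Proof.
move=> c0 t0 Pbnd e0 eP Jinf; apply: ge_ereal_sup => u.
case=> [->|[r [r0 [x [Y [Ax YL Ycl Yfin sub]]]] <-]]; rewrite lee_fin //.
suff key d : 0 < d -> r * (1 - d / c) <= t * (1 + d).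
  have rt0 : 0 < r / c + t by rewrite ltr_pwDl // divr_gt0.
  (* This d makes the error term d (r / c + t) of [key] equal to s. *)
  apply/ler_addgt0Pr => s s0; have := key (s / (r / c + t)) (divr_gt0 s0 rt0).
  set d := s / _; have : d * (r / c + t) = s by rewrite divfK ?gt_eqF.
  by move=> <-; lra.
move=> d0; have [N _ near_e] := weakly_null_near_subspace e0 YL Ycl Yfin d0.
have [i /near_e[y Yy ey] Ji] := Jinf N.
have [ei1 Pei] := eP i.
have d1 : 0 < 1 + d by rewrite addr_gt0.
have Py : 1 - d / c <= `|P i y|.
  have : `|P i (e i - y)| <= d / c.
    by rewrite ler_pdivlMr // mulrC (le_trans (Pbnd _ _)).
  rewrite linearB Pei => H; have := ler_normB (e i) (e i - P i y).
  rewrite subKr ei1 => H'; have := ler_normD (e i - P i y) (P i y).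
  by rewrite subrK ei1; lra.
have y1 : `|(1 + d)^-1 *: y| <= 1.
  rewrite normrZ gtr0_norm ?invr_gt0 // mulrC ler_pdivrMr // mul1r -ei1.
  by rewrite -(subrK (e i) y) addrC (le_trans (ler_normD _ _)) // lerD // distrC.
have Yy1 : Y ((1 + d)^-1 *: y) by exact: subspaceZ.
have inA (b : R) : `|b| = 1 -> `|P i x + b *: ((r / (1 + d)) *: P i y)| <= t.
  move=> b1; have [_ /(_ i Ji)] : slab (x + r *: (b *: ((1 + d)^-1 *: y))).
    apply: sub; exists (b *: ((1 + d)^-1 *: y)) => //; split; last exact: subspaceZ.
    by rewrite /unit_ball /= normrZ b1 mul1r.
  by rewrite linearD !linearZ /= !scalerA mulrAC.
have := inA 1 (normr1 _); have := inA (-1) (normrN1 _).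
rewrite scaleN1r scale1r; set w := _ *: P i y => Hm Hp.
have : `|w| <= t.
  have := ler_normB (P i x + w) (P i x - w).
  rewrite opprB addrC addrA subrK -mulr2n normrMn; lra.
rewrite normrZ gtr0_norm ?divr_gt0 // mulrAC ler_pdivrMr // => rP.
by apply: le_trans rP; rewrite ler_wpM2l // ltW.
Qed.

End Slabs.

(** Pigeonhole: otherwise each of the n residue classes contains an index with
    a i > t, and these n distinct indices alone make the sum of the q-th powers
    exceed n t^q. *)
Lemma small_residue_class (R : realType) (a : nat -> R) (q t : R) (n : nat) :
  0 < q -> 0 <= t -> (0 < n)%N -> (forall i, 0 <= a i) ->
  (forall N, \sum_(i < N) a i `^ q <= n%:R * t `^ q) ->
  exists k : 'I_n, forall i, (i %% n)%N = k -> a i <= t.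
Proof.
move=> q0 t0 n0 a0 asum; apply: contrapT => H.
have /choice[j jP] : forall k : 'I_n, exists i, (i %% n)%N = k /\ t < a i.
  move=> k; apply: contrapT => Hk; apply: H; exists k => i ik.
  by rewrite leNgt; apply/negP => ti; apply: Hk; exists i.
pose N := (\max_(k < n) j k).+1.
have jN k : (j k < N)%N by rewrite ltnS; exact: leq_bigmax.
suff : n%:R * t `^ q < \sum_(i < N) a i `^ q by rewrite ltNge asum.
pose res (i : 'I_N) : 'I_n := Ordinal (ltn_pmod i n0).
rewrite (partition_big res xpredT) //=.
have -> : n%:R * t `^ q = \sum_(k < n) t `^ q.
  by rewrite sumr_const card_ord mulr_natl.
apply: ltr_sum => [|k _].
  by apply/hasP; exists (Ordinal n0) => //; rewrite mem_index_enum.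
have [jk tj] := jP k.
rewrite (bigD1 (Ordinal (jN k))) /=; last by apply/eqP/val_inj.
rewrite ltr_wpDr //; first by apply: sumr_ge0 => i _; exact: powR_ge0.
by apply: gt0_ltr_powR; rewrite ?nnegrE.
Qed.

(** * The estimate *)

Theorem theorem2p1 (R : realType) (X : completeNormedModType R)
  (E : nat -> set X) (q : R)
  (X_separable : separable_space X)
  (E_FDD : is_FDD E)
  (E_shrinking : shrinking E)
  (q_ge1 : 1 <= q)
  (E_lower : lower_estimate E q) :
  exists2 C : R, 0 < C &
    forall n : nat, (0 < n)%N ->
      (covering_index X n <= (C * n%:R `^ (- q^-1))%:E)%E.
Proof.
have [c c0 low] := E_lower.
have q0 : 0 < q by apply: lt_le_trans q_ge1.
have [P [EP Pcvg PE]] := FDD_coordinates E_FDD.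
have Psum x n : c * (\sum_(i < n) `|P i x| `^ q) `^ q^-1 <= `|x|.
  exact: lower_estimate_expansion low.
have powRK (a : R) : 0 <= a -> (a `^ q) `^ q^-1 = a.
  by move=> a0; rewrite -powRrM mulfV ?gt_eqF // powRr1.
have powRVK (a : R) : 0 <= a -> (a `^ q^-1) `^ q = a.
  by move=> a0; rewrite -powRrM mulVf ?gt_eqF // powRr1.
have Pbnd i x : c * `|P i x| <= `|x|.
  apply: le_trans (Psum x i.+1); rewrite ler_pM2l // -[leLHS]powRK //.
  apply: ge0_ler_powR; rewrite ?nnegrE ?invr_ge0 ?(ltW q0) ?powR_ge0 //.
    by apply: sumr_ge0 => j _; exact: powR_ge0.
  by rewrite big_ord_recr /= lerDr sumr_ge0 // => j _; exact: powR_ge0.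
have [e eP] := FDD_unit_vectors E_FDD.
have e0 : weakly_null e.
  apply: shrinking_weakly_null E_shrinking _ => i.
  by have [? ->] := eP i.
exists c^-1; first by rewrite invr_gt0.
move=> n n0; set t := c^-1 * _.
have t0 : 0 <= t by rewrite mulr_ge0 ?powR_ge0 // invr_ge0 ltW.
pose A (k : 'I_n) := slab P [set i | (i %% n)%N = k] t.
apply: (@le_trans _ _ (\big[maxe/0%E]_(k < n) essential_inradius (A k))%E).
  apply: ereal_inf_lbound; exists A => //; split.
    by move=> k; exact: slab_bounded_closed_convex Pbnd.
  apply/seteqP; split=> [x [k _ []] //|x x1].
  have [|k kP] := @small_residue_class R (fun i => `|P i x|) q t n q0 t0 n0
    (fun i => normr_ge0 _); last by exists k.
  move=> N; set S := \sum_(i < N) _.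
  have S0 : 0 <= S by apply: sumr_ge0 => i _; exact: powR_ge0.
  have -> : n%:R * t `^ q = c^-1 `^ q.
    rewrite /t powRM ?powR_ge0 ?invr_ge0 ?(ltW c0) // -(powRrM n%:R) mulNr.
    rewrite mulVf ?gt_eqF // powR_inv1 // mulrCA mulfV ?mulr1 //.
    by rewrite pnatr_eq0 -lt0n.
  rewrite -[S]powRVK //; apply: ge0_ler_powR;
    rewrite ?nnegrE ?invr_ge0 ?powR_ge0 ?(ltW q0) ?(ltW c0) //.
  by rewrite -[leRHS]mulr1 ler_pdivlMl // (le_trans (Psum x N)).
apply: bigmax_le => [|k _]; first by rewrite lee_fin.
apply: (slab_essential_inradius c0 t0 Pbnd e0) => [i|N].
  by have [Ee ei1] := eP i; split=> //; exact: PE.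
exists (k + n * N)%N; first by rewrite (leq_trans (leq_pmull N n0)) // leq_addl.
by rewrite /= addnC mulnC modnMDl modn_small.
Qed.
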